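(* The complexes $(\mathcal M_\bullet,\partial_{\mathrm{del}})$, $(\mathcal M_\bullet,\partial^{\mathrm{tot}}_{\mathrm{del}})$, $(\mathcal M_\bullet,\partial_{\mathrm{con}})$ and $(\mathcal M_\bullet,\partial^{\mathrm{tot}}_{\mathrm{con}})$ are all acyclic (have zero homology in every degree).
   Context: Matroids have finite ground set $E(\mathsf M)$, rank $\mathrm{rk}(\mathsf M)$ and nullity $\mathrm{nul}(\mathsf M)=|E(\mathsf M)|-\mathrm{rk}(\mathsf M)$; loops, coloops, deletion and contraction are standard. An orientation of $\mathsf M$ is a generator $\eta$ of $\bigwedge^{|E|}\mathbb{Z}\langle E\rangle$, $E=E(\mathsf M)$; the empty matroid $\varnothing$ has orientation $1$. A matroid isomorphism $\psi$ induces $\psi_*$ on top exterior powers. $\mathcal M$ is the $\mathbb{Q}$-vector space spanned by symbols $[\mathsf M,\eta]$ modulo $[\mathsf M,-\eta]=-[\mathsf M,\eta]$ and $[\mathsf M,\eta]=[\mathsf M',\psi_*\eta]$ for every isomorphism $\psi:\mathsf M\to\mathsf M'$; $\mathcal M_\bullet$ denotes $\mathcal M$ graded by ground-set size. With $\iota_x$ interior product ($\iota_x(x\wedge\alpha)=\alpha$): $\partial_{\mathrm{del}}[\mathsf M,\eta]=\sum_{x\text{ not a coloop}}[\mathsf M\setminus x,\iota_x\eta]$, $\partial_{\mathrm{clp}}$ the same sum over coloops, $\partial_{\mathrm{con}}[\mathsf M,\eta]=\sum_{x\text{ not a loop}}[\mathsf M/x,\iota_x\eta]$, $\partial_{\mathrm{lp}}$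 the same sum over loops, $\partial^{\mathrm{tot}}_{\mathrm{del}}=\partial_{\mathrm{del}}+\partial_{\mathrm{clp}}$, $\partial^{\mathrm{tot}}_{\mathrm{con}}=\partial_{\mathrm{lp}}+\partial_{\mathrm{con}}$; each lowers degree by one and squares to zero. *)

(* Defs.v *)
From HB Require Import structures.
From mathcomp Require Import all_boot all_order all_algebra.
From mathcomp Require Import finmap generic_quotient ring_quotient boolp.
From mathcomp.multinomials Require Import freeg.

Set Implicit Arguments.
Unset Strict Implicit.
Unset Printing Implicit Defensive.

Import GRing.Theory Num.Theory.
Local Open Scope fset_scope.
Local Open Scope ring_scope.
Local Open Scope quotient_scope.

Inductive lspan (R : nzRingType) (V : lmodType R) (P : V -> Prop) : V -> Prop :=
| lspan0 : lspan P 0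
| lspan_cons a u v : P u -> lspan P v -> lspan P (a *: u + v).

Section LinearSpan.
Context (R : nzRingType) (V : lmodType R) (P : V -> Prop).
Implicit Types u v : V.

Lemma lspanD u v : lspan P u -> lspan P v -> lspan P (u + v).
Proof.
elim=> [|a w u' Pw _ IH] Sv; first by rewrite add0r.
by rewrite -addrA; apply: lspan_cons => //; exact: IH.
Qed.

Lemma lspanZ a u : lspan P u -> lspan P (a *: u).
Proof.
elim=> [|b w u' Pw _ IH]; first by rewrite scaler0; exact: lspan0.
by rewrite scalerDr scalerA; exact: lspan_cons.
Qed.

Lemma lspanN u : lspan P u -> lspan P (- u).
Proof. by rewrite -scaleN1r; exact: lspanZ. Qed.

Lemma lspanB u v : lspan P u -> lspan P v -> lspan P (u - v).
Proof. by move=> ? /lspanN; exact: lspanD. Qed.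

Lemma lspan_gen u : P u -> lspan P u.
Proof. by move=> Pu; rewrite -[u]addr0 -[u]scale1r; apply: lspan_cons => //; exact: lspan0. Qed.

Lemma lspan_sum (I : Type) (r : seq I) (Q : pred I) (F : I -> V) :
  (forall i, Q i -> lspan P (F i)) -> lspan P (\sum_(i <- r | Q i) F i).
Proof. by move=> H; apply: big_ind => //; [exact: lspan0 | exact: lspanD]. Qed.

Lemma lspan_ind_lin (Q : V -> Prop) :
    Q 0 -> (forall a u v, Q u -> Q v -> Q (a *: u + v)) ->
    (forall u, P u -> Q u) ->
  forall v, lspan P v -> Q v.
Proof. by move=> Q0 QD QP v; elim=> // a u w Pu _ Qw; apply: QD => //; exact: QP. Qed.

End LinearSpan.

Section FreeLift.
Context (R : nzRingType) (S : choiceType) (V : lmodType R) (f : S -> V).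

HB.instance Definition _ := GRing.isZmodMorphism.Build {freeg S / R} V
  (fglift f) (lift_is_additive f).

Lemma scale_freegU a c s : a *: << c *g s >> = << a * c *g s >> :> {freeg S / R}.
Proof. by apply/eqP/freeg_eqP => t; rewrite coeffZ !coeffU mulrA. Qed.

Fact fglift_is_scalable : scalable (fglift f).
Proof.
move=> a v; rewrite -[v]freeg_sumE scaler_sumr 2!(raddf_sum (fglift f)) scaler_sumr.
by apply: eq_bigr => s _ /=; rewrite scale_freegU !liftU scalerA.
Qed.

HB.instance Definition _ := GRing.isScalable.Build R {freeg S / R} V *:%R
  (fglift f) fglift_is_scalable.

End FreeLift.

Section Presented.
Context (R : nzRingType) (S : choiceType) (rel : {freeg S / R} -> Prop).
Local Notation F := {freeg S / R}.

Definition relspan : {pred F} := fun v => `[< lspan rel v >].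

Lemma relspan_zmod_closed : zmod_closed relspan.
Proof.
split=> [|u v /asboolP Su /asboolP Sv]; apply/asboolP; first exact: lspan0.
exact: lspanB.
Qed.

HB.instance Definition _ := GRing.isZmodClosed.Build F relspan relspan_zmod_closed.


Definition presented : Type := Quotient.quot relspan.

HB.instance Definition _ := Choice.on presented.
HB.instance Definition _ := GRing.Zmodule.on presented.

Definition pres (v : F) : presented := \pi_(Quotient.quot relspan) v.

Fact pres_is_zmod_morphism : zmod_morphism pres.
Proof. by move=> u v; rewrite /pres raddfB. Qed.
HB.instance Definition _ :=
  GRing.isZmodMorphism.Build F presented pres pres_is_zmod_morphism.

Lemma presP (u v : F) : pres u = pres v <-> lspan rel (u - v).
Proof.
rewrite /pres; split=> [/eqP|h]; last apply/eqP.
  by rewrite -Quotient.idealrBE => /asboolP.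
by rewrite -Quotient.idealrBE; apply/asboolP.
Qed.

Definition pres_repr (q : presented) : F := repr (q : Quotient.quot relspan).

Lemma pres_reprK : cancel pres_repr pres.
Proof. exact: reprK. Qed.

Lemma pres_rel r : rel r -> pres r = 0.
Proof. by move=> rr; rewrite -(raddf0 pres); apply/presP; rewrite subr0; exact: lspan_gen. Qed.

Definition pres_scale (a : R) (q : presented) : presented :=
  pres (a *: pres_repr q).

Lemma pres_scaleE a v : pres_scale a (pres v) = pres (a *: v).
Proof.
apply/presP; rewrite -scalerBr; apply: lspanZ; apply/presP.
exact: pres_reprK.
Qed.

Fact pres_scaleA a b q : pres_scale a (pres_scale b q) = pres_scale (a * b) q.
Proof. by rewrite [pres_scale b q]/pres_scale pres_scaleE scalerA. Qed.

Fact pres_scale1 : left_id 1 pres_scale.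
Proof. by move=> q; rewrite /pres_scale scale1r pres_reprK. Qed.

Fact pres_scaleDr : right_distributive pres_scale +%R.
Proof.
move=> a p q; rewrite -[p]pres_reprK -[q]pres_reprK -raddfD !pres_scaleE.
by rewrite scalerDr raddfD.
Qed.

Fact pres_scaleDl q : {morph pres_scale^~ q : a b / a + b}.
Proof. by move=> a b; rewrite /pres_scale scalerDl raddfD. Qed.

HB.instance Definition _ := GRing.Zmodule_isLmodule.Build R presented
  pres_scaleA pres_scale1 pres_scaleDr pres_scaleDl.

Fact pres_is_scalable : scalable pres.
Proof. by move=> a v; rewrite -pres_scaleE. Qed.
HB.instance Definition _ :=
  GRing.isScalable.Build R F presented *:%R pres pres_is_scalable.

Definition gen (s : S) : presented := pres << s >>.

Lemma presE v : pres v = \sum_(s <- dom v) coeff s v *: gen s.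
Proof.
rewrite -{1}[v]freeg_sumE raddf_sum; apply: eq_bigr => s _ /=.
by rewrite /gen -linearZ /= scale_freegU mulr1.
Qed.

Lemma presented_span q : lspan (fun u => exists s, u = gen s) q.
Proof.
rewrite -[q]pres_reprK presE; apply: lspan_sum => s _.
by apply: lspanZ; apply: lspan_gen; exists s.
Qed.

Definition respects (V : lmodType R) (f : S -> V) : Prop :=
  forall r, rel r -> fglift f r = 0.

Definition extend (V : lmodType R) (f : S -> V) (_ : respects f)
  (q : presented) : V := fglift f (pres_repr q).

Section Extend.
Context (V : lmodType R) (f : S -> V) (fr : respects f).

Lemma extendE v : extend fr (pres v) = fglift f v.
Proof.
apply/eqP; rewrite -subr_eq0 -raddfB; apply/eqP.
have: lspan rel (pres_repr (pres v) - v) by apply/presP; exact: pres_reprK.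
elim=> [|a u w ru _ IH]; first exact: raddf0.
by rewrite raddfD /= IH fglift_is_scalable fr // scaler0 addr0.
Qed.

Fact extend_is_linear : linear (extend fr).
Proof.
move=> a p q; rewrite -[p]pres_reprK -[q]pres_reprK -linearP !extendE.
by rewrite raddfD /= fglift_is_scalable.
Qed.

HB.instance Definition _ :=
  GRing.isLinear.Build R presented V *:%R (extend fr) extend_is_linear.

Lemma extend_gen s : extend fr (gen s) = f s.
Proof. by rewrite /gen extendE liftU scale1r. Qed.

End Extend.

Lemma presented_ind (Q : presented -> Prop) :
    Q 0 -> (forall a u v, Q u -> Q v -> Q (a *: u + v)) ->
    (forall s, Q (gen s)) -> forall q, Q q.
Proof.
move=> Q0 QD Qg q; apply: (lspan_ind_lin Q0 QD _ (presented_span q)).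
by move=> _ [s ->].
Qed.

End Presented.

(* The exterior algebra of Z<K>, presented as the tensor algebra (spanned by  *)
(* words in K) modulo the two-sided ideal generated by the squares of the     *)
(* vectors: for v = \sum_x a_x x, the square v * v is the sum of the          *)
(* a_x ^+ 2 (x * x) and of the a_x a_y (x * y + y * x) over pairs x != y.     *)
Variant ext_rel (K : choiceType) : {freeg (seq K) / int} -> Prop :=
| ExtSquare u x v : ext_rel << u ++ x :: x :: v >>
| ExtSwap u x y v :
    ext_rel (<< u ++ x :: y :: v >> + << u ++ y :: x :: v >>).

Definition ext (K : choiceType) : Type := presented (@ext_rel K).
HB.instance Definition _ (K : choiceType) := Choice.on (ext K).
HB.instance Definition _ (K : choiceType) := GRing.Lmodule.on (ext K).

Section Exterior.
Context (K : choiceType).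
Implicit Types (x y : K) (u v w : seq K) (a b : ext K) (E : {fset K}).

(* [:: x1; ...; xk] |-> x1 /\ ... /\ xk *)
Definition wedge w : ext K := gen (@ext_rel K) w.

Lemma ext_ind (Q : ext K -> Prop) :
    Q 0 -> (forall k a b, Q a -> Q b -> Q (k *: a + b)) ->
    (forall w, Q (wedge w)) -> forall a, Q a.
Proof. exact: presented_ind. Qed.

Lemma wedge_square u x v : wedge (u ++ x :: x :: v) = 0.
Proof. by apply: pres_rel; exact: ExtSquare. Qed.

Lemma wedge_swap u x y v :
  wedge (u ++ x :: y :: v) = - wedge (u ++ y :: x :: v).
Proof.
apply/eqP; rewrite -addr_eq0 -raddfD; apply/eqP.
by apply: pres_rel; exact: ExtSwap.
Qed.

Lemma ext_respects (V : lmodType int) (f : seq K -> V) :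
    (forall u x v, f (u ++ x :: x :: v) = 0) ->
    (forall u x y v, f (u ++ x :: y :: v) + f (u ++ y :: x :: v) = 0) ->
  respects (@ext_rel K) f.
Proof.
move=> f2 fS _ [u x v|u x y v]; first by rewrite liftU scale1r.
by rewrite raddfD /= !liftU !scale1r.
Qed.

Fact mulx_respects x : respects (@ext_rel K) (fun w => wedge (x :: w)).
Proof.
apply: ext_respects => [u y v|u y z v]; first exact: (wedge_square (x :: u)).
by rewrite (wedge_swap (x :: u)) addNr.
Qed.

(* a |-> x /\ a *)
Definition mulx x : ext K -> ext K := extend (mulx_respects x).
HB.instance Definition _ x := GRing.Linear.on (mulx x).

Lemma mulxE x w : mulx x (wedge w) = wedge (x :: w).
Proof. exact: extend_gen. Qed.

Lemma mulxx x a : mulx x (mulx x a) = 0.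
Proof.
elim/ext_ind: a => [|k a b IHa IHb|w]; first by rewrite !linear0.
  by rewrite !linearP /= IHa IHb scaler0 addr0.
by rewrite !mulxE (wedge_square [::]).
Qed.

Lemma mulxC x y a : mulx x (mulx y a) = - mulx y (mulx x a).
Proof.
elim/ext_ind: a => [|k a b IHa IHb|w]; first by rewrite !linear0.
  by rewrite !linearP /= IHa IHb.
by rewrite !mulxE (wedge_swap [::]).
Qed.

Fixpoint interior_word x w : ext K :=
  if w is y :: w' then (x == y)%:R *: wedge w' - mulx y (interior_word x w')
  else 0.

Fact interior_respects x : respects (@ext_rel K) (interior_word x).
Proof.
apply: ext_respects => [u y v|u y z v].
  elim: u => [|z u IHu] /=.
    by rewrite linearB linearZ /= mulxE mulxx subr0 subrr.
  by rewrite IHu raddf0 subr0 wedge_square scaler0.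
elim: u => [|t u IHu] /=.
  rewrite !linearB !linearZ /= !mulxE (mulxC z y) !scalerN !opprK.
  rewrite addrACA [X in _ + X]addrACA subrr addr0 -opprD.
  by rewrite [X in X - _]addrC subrr.
rewrite wedge_swap scalerN addrACA addNr add0r -opprD -raddfD /= IHu.
by rewrite raddf0 oppr0.
Qed.

(* The interior product iota_x, i.e. the antiderivation of the exterior       *)
(* algebra mapping x to 1 and every other y in K to 0.                        *)
Definition interior x : ext K -> ext K := extend (interior_respects x).
HB.instance Definition _ x := GRing.Linear.on (interior x).

Lemma interiorE x w : interior x (wedge w) = interior_word x w.
Proof. exact: extend_gen. Qed.

Lemma interior_mulx x y a :
  interior x (mulx y a) = (x == y)%:R *: a - mulx y (interior x a).
Proof.
elim/ext_ind: a => [|k a b IHa IHb|w].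
- by rewrite !linear0 addr0.
- by rewrite !linearP /= IHa IHb scalerDr addrACA.
- by rewrite mulxE !interiorE.
Qed.

Fact pushforward_respects (f : K -> K) :
  respects (@ext_rel K) (fun w => wedge (map f w)).
Proof.
apply: ext_respects => [u x v|u x y v]; rewrite !map_cat /=.
  exact: wedge_square.
by rewrite wedge_swap addNr.
Qed.

Definition pushforward (f : K -> K) : ext K -> ext K :=
  extend (pushforward_respects f).
HB.instance Definition _ f := GRing.Linear.on (pushforward f).

Lemma pushforwardE f w : pushforward f (wedge w) = wedge (map f w).
Proof. exact: extend_gen. Qed.

(* The n-th exterior power of Z<E>, inside the exterior algebra of Z<K>. *)
Definition extpow (n : nat) E : ext K -> Prop :=
  lspan (fun a => exists w,
    [/\ size w = n, {subset w <= E} & a = wedge w]).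

Definition orientation E (eta : ext K) : Prop :=
  extpow #|` E| E eta /\
  forall a, extpow #|` E| E a -> exists k : int, a = k *: eta.

End Exterior.

Section Orientation.
Context (K : choiceType).
Implicit Types (x y : K) (u v w : seq K) (a b : ext K) (E : {fset K}).

Lemma wedge_mem x w : x \in w -> wedge (x :: w) = 0.
Proof.
elim: w => // y w IHw; rewrite inE; have [<- _|_ /= xw] := eqVneq x y.
  exact: (wedge_square [::]).
by rewrite (wedge_swap [::]) /= -mulxE IHw // linear0 oppr0.
Qed.

Lemma wedge_nuniq w : ~~ uniq w -> wedge w = 0.
Proof.
elim: w => //= x w IHw; rewrite negb_and negbK => /orP[/wedge_mem //|nu].
by rewrite -mulxE IHw // linear0.
Qed.

Lemma extpow_wedge n E w : size w = n -> {subset w <= E} -> extpow n E (wedge w).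
Proof. by move=> sw wE; apply: lspan_gen; exists w. Qed.

Lemma extpow_mulx n E x a :
  x \in E -> extpow n E a -> extpow n.+1 E (mulx x a).
Proof.
move=> xE; elim/lspan_ind_lin => [|k b c Hb Hc|_ [w [sw wE ->]]].
- by rewrite linear0; exact: lspan0.
- by rewrite linearP; apply: lspanD => //; exact: lspanZ.
- rewrite mulxE; apply: extpow_wedge; first by rewrite /= sw.
  by move=> y; rewrite inE => /predU1P[->|/wE].
Qed.

Lemma extpow_sub n E E' a : E `<=` E' -> extpow n E a -> extpow n E' a.
Proof.
move=> /fsubsetP EE'; elim/lspan_ind_lin => [|k b c Hb Hc|_ [w [sw wE ->]]].
- exact: lspan0.
- by apply: lspanD => //; exact: lspanZ.
- by apply: extpow_wedge => // y /wE /EE'.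
Qed.

Lemma interior_notin x w : x \notin w -> interior x (wedge w) = 0.
Proof.
rewrite interiorE; elim: w => //= y w IHw; rewrite inE negb_or => /andP[nxy xw].
by rewrite (negbTE nxy) scale0r IHw // linear0 subr0.
Qed.

Lemma extpow_interior0 n E x a :
  x \notin E -> extpow n E a -> interior x a = 0.
Proof.
move=> xE; elim/lspan_ind_lin => [|k b c Hb Hc|_ [w [sw wE ->]]].
- exact: linear0.
- by rewrite linearP /= Hb Hc scaler0 addr0.
- by apply: interior_notin; apply: contra xE; exact: wE.
Qed.

Lemma extpow_interior n E x a :
  extpow n.+1 E a -> extpow n (E `\ x) (interior x a).
Proof.
elim/lspan_ind_lin => [|k b c Hb Hc|_ [w [sw wE ->]]].
- by rewrite linear0; exact: lspan0.
- by rewrite linearP; apply: lspanD => //; exact: lspanZ.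
have [uw|/wedge_nuniq->] := boolP (uniq w); last by rewrite linear0; exact: lspan0.
have [xw|/interior_notin->] := boolP (x \in w); last exact: lspan0.
elim: w n sw wE uw xw => // y w IHw [|n] [sw] wE /= /andP[yw uw] xyw.
  move: xyw; rewrite (size0nil sw) mem_seq1 => /eqP <-.
  by rewrite interiorE /= eqxx scale1r linear0 subr0; exact: extpow_wedge.
have wE' : {subset w <= E} by move=> z zw; apply: wE; rewrite inE zw orbT.
rewrite -mulxE interior_mulx; have [exy|nxy] := eqVneq x y.
  rewrite scale1r interior_notin exy // linear0 subr0.
  apply: extpow_wedge => // z zw; rewrite !inE wE' // andbT.
  by apply: contraNneq yw => <-.
rewrite scale0r sub0r; apply/lspanN/extpow_mulx.
  by rewrite !inE eq_sym nxy wE // inE eqxx.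
by apply: IHw => //; move: xyw; rewrite inE (negbTE nxy).
Qed.

Lemma orientation_interior E x eta :
  x \in E -> orientation E eta -> orientation (E `\ x) (interior x eta).
Proof.
move=> xE [eE gen_eta].
have cE : #|` E| = #|` E `\ x|.+1 by rewrite (cardfsD1 x E) xE add1n.
split; first by apply: extpow_interior; rewrite -cE.
move=> a aE; have [|k ek] := gen_eta (mulx x a).
  by rewrite cE; apply: extpow_mulx => //; apply: extpow_sub aE; exact: fsubsetDl.
exists k; rewrite -linearZ /= -ek interior_mulx eqxx scale1r.
by rewrite (extpow_interior0 (negbT (fsetD11 x E)) aE) linear0 subr0.
Qed.

Lemma interiorC x y a : interior x (interior y a) = - interior y (interior x a).
Proof.
elim/ext_ind: a => [|k a b IHa IHb|w]; first by rewrite !linear0.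
  by rewrite !linearP /= IHa IHb.
elim: w => [|z w IHw]; first by rewrite !interiorE /= !linear0.
rewrite -mulxE !interior_mulx !(linearB (interior _)) !(linearZZ (interior _)) /=.
rewrite !interior_mulx IHw (linearN (mulx z)) /= opprK !opprB.
by rewrite opprD addrA addrAC.
Qed.

Lemma pushforward_mulx f x a :
  pushforward f (mulx x a) = mulx (f x) (pushforward f a).
Proof.
elim/ext_ind: a => [|k a b IHa IHb|w]; first by rewrite !linear0.
  by rewrite !linearP /= IHa IHb.
by rewrite mulxE !pushforwardE mulxE.
Qed.

Lemma pushforward_interior (f : K -> K) n E x a :
    {in E &, injective f} -> x \in E -> extpow n E a ->
  interior (f x) (pushforward f a) = pushforward f (interior x a).
Proof.
move=> injf xE; elim/lspan_ind_lin => [|k b c Hb Hc|_ [w [_ wE ->]]].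
- by rewrite !linear0.
- by rewrite !linearP /= Hb Hc.
elim: w wE => [|y w IHw] wE; first by rewrite pushforwardE !interiorE linear0.
have yE : y \in E by apply: wE; rewrite inE eqxx.
rewrite -mulxE pushforward_mulx !interior_mulx linearB linearZ /=.
rewrite pushforward_mulx IHw ?(inj_in_eq injf) //.
by move=> z zw; apply: wE; rewrite inE zw orbT.
Qed.

End Orientation.

Definition matroid_axioms (K : choiceType) (E : {fset K}) (I : {fset {fset K}}) :
    Prop :=
  [/\ forall A, A \in I -> A `<=` E,
      fset0 \in I,
      forall A B, B \in I -> A `<=` B -> A \in I &
      forall A B, A \in I -> B \in I -> (#|` A| < #|` B|)%N ->
        exists2 x, x \in B `\` A & x |` A \in I].

(* Matroids given by their independent sets, on finite subsets of the set K   *)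
(* of labels.                                                                 *)
Record matroid (K : choiceType) := Matroid {
  matroid_data : {fset K} * {fset {fset K}};
  _ : `[< matroid_axioms matroid_data.1 matroid_data.2 >] }.
HB.instance Definition _ K := [isSub for @matroid_data K].
HB.instance Definition _ (K : choiceType) := [Choice of matroid K by <:].

Section Matroid.
Context (K : choiceType).
Implicit Types (M N : matroid K) (x y : K) (A B : {fset K}).

Definition ground M : {fset K} := (matroid_data M).1.
Definition indep M : {fset {fset K}} := (matroid_data M).2.

Lemma matroidP M : matroid_axioms (ground M) (indep M).
Proof. by apply/asboolP; case: M. Qed.

Definition bases M : {fset {fset K}} :=
  [fset B in indep M | all (fun A => (B `<=` A) ==> (A == B)) (indep M)].

Definition loop M x : bool := (x \in ground M) && ([fset x] \notin indep M).

Definition coloop M x : bool := (x \in ground M) && all (fun B => x \in B) (bases M).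

Fact deletion_subproof M x :
  matroid_axioms (ground M `\ x) [fset A in indep M | x \notin A].
Proof.
have [IE I0 Isub Iaug] := matroidP M; split.
- move=> A; rewrite !inE /= => /andP[/IE AE xA].
  by rewrite fsubsetD1 AE.
- by rewrite !inE /= I0.
- move=> A B; rewrite !inE /= => /andP[IB xB] AB.
  by rewrite (Isub _ _ IB AB) /=; apply: contra xB; exact/fsubsetP.
- move=> A B; rewrite !inE /= => /andP[IA xA] /andP[IB xB] /(Iaug _ _ IA IB).
  case=> y yBA IyA; exists y => //; rewrite !inE /= IyA negb_or xA andbT.
  by move: yBA; rewrite inE => /andP[_]; apply: contraTneq => <-.
Qed.

Definition deletion M x : matroid K :=
  @Matroid K (ground M `\ x, [fset A in indep M | x \notin A])
    (introT (asboolP _) (deletion_subproof M x)).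

Definition contraction_indep M x : {fset {fset K}} :=
  if [fset x] \in indep M
  then [fset A in indep M | (x \notin A) && (x |` A \in indep M)]
  else [fset A in indep M | x \notin A].

Fact contraction_subproof M x :
  matroid_axioms (ground M `\ x) (contraction_indep M x).
Proof.
rewrite /contraction_indep; case: ifP => [Ix|_]; last exact: deletion_subproof.
have [IE I0 Isub Iaug] := matroidP M; split.
- move=> A; rewrite !inE /= => /and3P[/IE AE xA _].
  by rewrite fsubsetD1 AE.
- by rewrite !inE /= I0 fsetU0.
- move=> A B; rewrite !inE /= => /and3P[IB xB IxB] AB.
  rewrite (Isub _ _ IB AB) (Isub _ _ IxB (fsetUS _ AB)) andbT /=.
  by apply: contra xB; exact/fsubsetP.
- move=> A B; rewrite !inE /= => /and3P[IA xA IxA] /and3P[IB xB IxB] cAB.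
  have [|y] := Iaug _ _ IxA IxB; first by rewrite !cardfsU1 xA xB.
  rewrite !inE negb_or => /andP[/andP[nyx yA]]; rewrite (negbTE nyx) /= => yB.
  rewrite fsetUCA => IxyA; exists y; first by rewrite inE yA.
  rewrite !inE /= IxyA negb_or eq_sym nyx xA !andbT.
  by apply: Isub IxyA _; exact: fsubsetUr.
Qed.

Definition contraction M x : matroid K :=
  @Matroid K (ground M `\ x, contraction_indep M x)
    (introT (asboolP _) (contraction_subproof M x)).

(* Only the values of psi on the ground set of M are relevant. *)
Definition matroid_iso (psi : K -> K) M N : Prop :=
  [/\ {in ground M &, injective psi},
      psi @` ground M = ground N &
      forall A, A `<=` ground M -> (A \in indep M) = (psi @` A \in indep N)].

End Matroid.

Record osym (K : choiceType) := OSym {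
  osym_data : matroid K * ext K;
  _ : `[< orientation (ground osym_data.1) osym_data.2 >] }.
HB.instance Definition _ K := [isSub for @osym_data K].
HB.instance Definition _ (K : choiceType) := [Choice of osym K by <:].

Definition omat K (s : osym K) : matroid K := (osym_data s).1.
Definition oeta K (s : osym K) : ext K := (osym_data s).2.

Variant osym_rel (K : choiceType) : {freeg (osym K) / rat} -> Prop :=
| OsymOpp s t : omat t = omat s -> oeta t = - oeta s ->
    osym_rel (<< t >> + << s >>)
| OsymIso s t psi :
    matroid_iso psi (omat s) (omat t) -> oeta t = pushforward psi (oeta s) ->
    osym_rel (<< s >> - << t >>).

Definition mspace (K : choiceType) : Type := presented (@osym_rel K).
HB.instance Definition _ (K : choiceType) := Choice.on (mspace K).
HB.instance Definition _ (K : choiceType) := GRing.Lmodule.on (mspace K).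

Section Symbols.
Context (K : choiceType).
Implicit Types (M N : matroid K) (s t : osym K) (x y : K) (eta : ext K).

Definition oclass s : mspace K := gen (@osym_rel K) s.

Definition mdeg (n : nat) : mspace K -> Prop :=
  lspan (fun u => exists2 s, #|` ground (omat s)| = n & u = oclass s).

Lemma osymP s : orientation (ground (omat s)) (oeta s).
Proof. by apply/asboolP; case: s. Qed.

Fact minor_osym_subproof (op : matroid K -> K -> matroid K)
    (opE : forall M x, ground (op M x) = ground M `\ x)
    s (x : ground (omat s)) :
  orientation (ground (op (omat s) (val x))) (interior (val x) (oeta s)).
Proof.
by rewrite opE; apply: orientation_interior (osymP s); exact: valP.
Qed.

Definition minor_osym (op : matroid K -> K -> matroid K)
    (opE : forall M x, ground (op M x) = ground M `\ x)
    s (x : ground (omat s)) : osym K :=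
  @OSym K (op (omat s) (val x), interior (val x) (oeta s))
    (introT (asboolP _) (minor_osym_subproof opE x)).

Definition boundary_osym (op : matroid K -> K -> matroid K)
    (opE : forall M x, ground (op M x) = ground M `\ x)
    (P : matroid K -> pred K) s : mspace K :=
  \sum_(x : ground (omat s) | P (omat s) (val x)) oclass (minor_osym opE x).

(* The class [M, eta], with value 0 when eta is not an orientation of M; used *)
(* in proofs only.                                                            *)
Definition symbol M eta : mspace K :=
  if insub (M, eta) is Some s then oclass s else 0.

Lemma oclassE s : oclass s = symbol (omat s) (oeta s).
Proof.
rewrite /symbol; case: insubP => [t _ et|/asboolP[]]; last exact: osymP.
by congr oclass; apply: val_inj; rewrite et; exact: surjective_pairing.
Qed.

Lemma symbolE M eta (Ho : orientation (ground M) eta) :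
  symbol M eta = oclass (@OSym K (M, eta) (introT (asboolP _) Ho)).
Proof. by rewrite oclassE. Qed.

Lemma orientationN (E : {fset K}) eta : orientation E eta -> orientation E (- eta).
Proof.
case=> eE egen; split; first exact: lspanN.
by move=> a /egen[k ->]; exists (- k); rewrite scaleNr scalerN opprK.
Qed.

Lemma oclassN s t : omat t = omat s -> oeta t = - oeta s -> oclass t = - oclass s.
Proof.
move=> es et; apply/eqP; rewrite -addr_eq0 -raddfD; apply/eqP.
by apply: pres_rel; exact: OsymOpp.
Qed.

Lemma oclass_iso s t psi :
    matroid_iso psi (omat s) (omat t) -> oeta t = pushforward psi (oeta s) ->
  oclass t = oclass s.
Proof.
move=> st et; apply/esym/eqP; rewrite -subr_eq0 -raddfB; apply/eqP.
by apply: pres_rel; exact: OsymIso st et.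
Qed.

Lemma symbolN M eta : symbol M (- eta) = - symbol M eta.
Proof.
have [Ho|nHo] := pselect (orientation (ground M) eta).
  by rewrite (symbolE (orientationN Ho)) (symbolE Ho); exact: oclassN.
rewrite /symbol !insubN ?oppr0 //; apply/asboolP => // /orientationN.
by rewrite opprK.
Qed.

Lemma symbol_iso M N eta psi :
    orientation (ground M) eta -> orientation (ground N) (pushforward psi eta) ->
    matroid_iso psi M N ->
  symbol N (pushforward psi eta) = symbol M eta.
Proof.
by move=> HM HN iMN; rewrite (symbolE HM) (symbolE HN); apply: (@oclass_iso _ _ psi).
Qed.

Section Boundary.
Context (op : matroid K -> K -> matroid K) (P : matroid K -> pred K).
Context (opE : forall M x, ground (op M x) = ground M `\ x).

Lemma boundary_osymE s : boundary_osym opE P s =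
  \sum_(x <- ground (omat s) | P (omat s) x)
     symbol (op (omat s) x) (interior x (oeta s)).
Proof. by rewrite big_seq_fsetE; apply: eq_bigr => x _; rewrite oclassE. Qed.

Definition iso_compatible : Prop :=
  forall psi M N x, matroid_iso psi M N -> x \in ground M ->
    P N (psi x) = P M x /\ matroid_iso psi (op M x) (op N (psi x)).

Lemma boundary_respects : iso_compatible -> respects (@osym_rel K) (boundary_osym opE P).
Proof.
move=> isoP _ [s t es et|s t psi iso et].
  rewrite raddfD /= !liftU !scale1r !boundary_osymE es et -big_split big1 //= => x _.
  by rewrite linearN /= symbolN addNr.
rewrite raddfB /= !liftU !scale1r; apply/eqP; rewrite subr_eq0; apply/eqP.
have [injpsi im _] := iso; rewrite !boundary_osymE -im.
have pe : perm_eq (psi @` ground (omat s)) (map psi (ground (omat s))).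
  apply: uniq_perm; rewrite ?fset_uniq ?map_inj_in_uniq ?fset_uniq //.
  by move=> y; apply/imfsetP/mapP.
rewrite (perm_big _ pe) big_map /= big_seq_cond [RHS]big_seq_cond.
apply: eq_big => [x|x /andP[xE _]].
  by case: (boolP (x \in _)) => //= xE; have [->] := isoP _ _ _ _ iso xE.
have [_ iso'] := isoP _ _ _ _ iso xE.
have Hs := osymP s; have Ht := osymP t; rewrite et.
have HI : interior (psi x) (pushforward psi (oeta s)) =
  pushforward psi (interior x (oeta s)).
  by apply: pushforward_interior injpsi xE _; case: Hs => Hs _; exact: Hs.
rewrite HI; apply/esym/symbol_iso => //; rewrite opE.
  exact: orientation_interior.
rewrite -HI -et; apply: orientation_interior => //.
by rewrite -im; apply: in_imfset.
Qed.

End Boundary.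
End Symbols.

Section MatroidIso.
Context (K : choiceType).
Implicit Types (M N : matroid K) (x y : K) (A B : {fset K}).

Lemma indepS M A B : B \in indep M -> A `<=` B -> A \in indep M.
Proof. by have [_ _ + _] := matroidP M; apply. Qed.

Lemma indep_ground M A : A \in indep M -> A `<=` ground M.
Proof. by have [+ _ _ _] := matroidP M; apply. Qed.

Lemma mem_deletion M x A : (A \in indep (deletion M x)) = (A \in indep M) && (x \notin A).
Proof. by rewrite !inE. Qed.

Lemma mem_contraction M x A : (A \in indep (contraction M x)) =
  (x \notin A) && ((if [fset x] \in indep M then x |` A else A) \in indep M).
Proof.
rewrite {1}/indep /= /contraction_indep; case: ifP => _; rewrite !inE /=.
  case: (boolP (x |` A \in _)) => [IxA|]; last by rewrite !andbF.
  by rewrite (indepS IxA) // fsubsetUr.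
by rewrite andbC.
Qed.

Lemma basesP M B : reflect
  (B \in indep M /\ forall A, A \in indep M -> B `<=` A -> A = B) (B \in bases M).
Proof.
rewrite !inE /=; apply: (iffP andP) => -[IB mB]; split=> //.
  by move=> A IA BA; apply/eqP; have /implyP := allP mB A IA; apply.
by apply/allP => A IA; apply/implyP => BA; apply/eqP; exact: mB.
Qed.

Section Iso.
Context (psi : K -> K) (M N : matroid K) (iso : matroid_iso psi M N).

Lemma iso_mem A x : A `<=` ground M -> x \in ground M -> (psi x \in psi @` A) = (x \in A).
Proof.
have [injpsi _ _] := iso; move=> /fsubsetP AE xE.
apply/imfsetP/idP => [[y /= yA exy]|xA]; last by exists x.
by rewrite (injpsi x y) // AE.
Qed.

Lemma iso_sub A B : A `<=` ground M -> B `<=` ground M ->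
  (psi @` A `<=` psi @` B) = (A `<=` B).
Proof.
move=> AE BE; apply/fsubsetP/fsubsetP => AB y.
  by move=> yA; rewrite -(iso_mem BE) ?(fsubsetP AE) // AB // in_imfset.
by case/imfsetP => x /= /AB xB ->; rewrite in_imfset.
Qed.

Lemma iso_lift B : B `<=` ground N -> exists2 A, A `<=` ground M & B = psi @` A.
Proof.
have [_ im _] := iso; move=> /fsubsetP BE.
exists [fset x in ground M | psi x \in B].
  by apply/fsubsetP => x; rewrite !inE => /andP[].
apply/fsetP => y; apply/idP/imfsetP => [yB|[x /=]].
  have := BE _ yB; rewrite -im => /imfsetP[x /= xE ey].
  by exists x => //; rewrite !inE /= xE -ey.
by rewrite !inE /= => /andP[_ ?] ->.
Qed.

Lemma iso_ground x : x \in ground M -> psi x \in ground N.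
Proof. by have [_ <- _] := iso; move=> xE; rewrite in_imfset. Qed.

Lemma iso_bases A : A `<=` ground M -> (psi @` A \in bases N) = (A \in bases M).
Proof.
have [_ _ isoI] := iso; move=> AE.
apply/basesP/basesP => -[IA mA]; split; rewrite ?isoI // -?isoI //.
  move=> B IB AB; have BE := indep_ground IB.
  have eAB : psi @` B = psi @` A by apply: mA; rewrite ?iso_sub // -isoI.
  by apply/eqP; rewrite eqEfsubset AB andbT -iso_sub // eAB.
move=> B IB AB; have [B' B'E eB] := iso_lift (indep_ground IB).
move: IB AB; rewrite eB iso_sub // -isoI // => IB' AB'.
by rewrite (mA B').
Qed.

Lemma iso_coloop x : x \in ground M -> coloop N (psi x) = coloop M x.
Proof.
move=> xE; rewrite /coloop xE iso_ground //=.
apply/allP/allP => H B /[dup] bB /basesP[/indep_ground BE _].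
  by rewrite -(iso_mem BE) //; apply: H; rewrite iso_bases.
have [A AE eB] := iso_lift BE; rewrite eB iso_mem //.
by apply: H; rewrite -iso_bases // -eB.
Qed.

Lemma iso_loop x : x \in ground M -> loop N (psi x) = loop M x.
Proof.
have [_ _ isoI] := iso; move=> xE; rewrite /loop xE iso_ground //=.
by rewrite isoI ?fsub1set // imfset_fset1.
Qed.

Lemma iso_minor (op : matroid K -> K -> matroid K) x :
    (forall M x, ground (op M x) = ground M `\ x) -> x \in ground M ->
    (forall A, A `<=` ground M `\ x ->
      (A \in indep (op M x)) = (psi @` A \in indep (op N (psi x)))) ->
  matroid_iso psi (op M x) (op N (psi x)).
Proof.
have [injpsi im _] := iso; move=> opE xE Hop.
have sE : ground M `\ x `<=` ground M by exact: fsubsetDl.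
split; rewrite ?opE //.
  by move=> y z /(fsubsetP sE) yE /(fsubsetP sE); exact: injpsi.
apply/fsetP => y; rewrite !inE -im; apply/imfsetP/andP => [[z /=]|].
  rewrite !inE => /andP[nzx zE] ->; rewrite in_imfset //; split=> //.
  by apply: contra nzx => /eqP /injpsi ->.
case=> nyx /imfsetP[z /= zE ey]; exists z => //=; rewrite !inE zE andbT.
by apply: contra nyx => /eqP <-; rewrite ey.
Qed.

End Iso.

Lemma iso_deletion psi M N x : matroid_iso psi M N -> x \in ground M ->
  matroid_iso psi (deletion M x) (deletion N (psi x)).
Proof.
move=> iso xE; apply: iso_minor => // A; rewrite fsubsetD1 => /andP[AE xA].
have [_ _ isoI] := iso.
by rewrite !mem_deletion isoI // (iso_mem iso).
Qed.

Lemma iso_contraction psi M N x : matroid_iso psi M N -> x \in ground M ->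
  matroid_iso psi (contraction M x) (contraction N (psi x)).
Proof.
move=> iso xE; apply: iso_minor => // A; rewrite fsubsetD1 => /andP[AE xA].
have [_ _ isoI] := iso.
rewrite !mem_contraction (iso_mem iso) // (isoI [fset x]) ?fsub1set // imfset_fset1.
case: ifP => _; rewrite isoI // ?imfsetU1 //.
by rewrite fsubUset fsub1set xE.
Qed.

End MatroidIso.

Section Boundaries.
Context (K : choiceType).
Implicit Types (M N : matroid K) (x y : K) (v : mspace K).

Definition noncoloop M x : bool := ~~ coloop M x.
Definition nonloop M x : bool := ~~ loop M x.

Fact deletion_ground M x : ground (deletion M x) = ground M `\ x.
Proof. by []. Qed.

Fact contraction_ground M x : ground (contraction M x) = ground M `\ x.
Proof. by []. Qed.

Fact del_respects :
  respects (@osym_rel K) (boundary_osym deletion_ground noncoloop).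
Proof.
apply: boundary_respects => psi M N x iso xE; split; last exact: iso_deletion.
by rewrite /noncoloop (iso_coloop iso).
Qed.

Fact clp_respects :
  respects (@osym_rel K) (boundary_osym deletion_ground (@coloop K)).
Proof.
apply: boundary_respects => psi M N x iso xE; split; last exact: iso_deletion.
by rewrite (iso_coloop iso).
Qed.

Fact con_respects :
  respects (@osym_rel K) (boundary_osym contraction_ground nonloop).
Proof.
apply: boundary_respects => psi M N x iso xE; split; last exact: iso_contraction.
by rewrite /nonloop (iso_loop iso).
Qed.

Fact lp_respects :
  respects (@osym_rel K) (boundary_osym contraction_ground (@loop K)).
Proof.
apply: boundary_respects => psi M N x iso xE; split; last exact: iso_contraction.
by rewrite (iso_loop iso).
Qed.

Definition bd_del : mspace K -> mspace K := extend del_respects.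
Definition bd_clp : mspace K -> mspace K := extend clp_respects.
Definition bd_con : mspace K -> mspace K := extend con_respects.
Definition bd_lp : mspace K -> mspace K := extend lp_respects.
HB.instance Definition _ := GRing.Linear.on bd_del.
HB.instance Definition _ := GRing.Linear.on bd_clp.
HB.instance Definition _ := GRing.Linear.on bd_con.
HB.instance Definition _ := GRing.Linear.on bd_lp.

Definition bd_del_tot : mspace K -> mspace K := bd_del \+ bd_clp.
Definition bd_con_tot : mspace K -> mspace K := bd_lp \+ bd_con.
HB.instance Definition _ := GRing.Linear.on bd_del_tot.
HB.instance Definition _ := GRing.Linear.on bd_con_tot.

End Boundaries.

Section MatroidMinors.
Context (K : choiceType).
Implicit Types (M N : matroid K) (x y : K) (A B I J : {fset K}).

Lemma matroid_ext M N : ground M = ground N ->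
  (forall A, (A \in indep M) = (A \in indep N)) -> M = N.
Proof.
move=> eE eI; apply: val_inj; rewrite /= [LHS]surjective_pairing.
by rewrite [RHS]surjective_pairing; congr pair => //; apply/fsetP.
Qed.

Lemma ground_minorC (op : matroid K -> K -> matroid K) M x y :
    (forall M x, ground (op M x) = ground M `\ x) ->
  ground (op (op M x) y) = ground (op (op M y) x).
Proof. by move=> opE; rewrite !opE; apply/fsetP => z; rewrite !inE andbCA. Qed.

Lemma indep_aug M I J : I \in indep M -> J \in indep M -> (#|` I| <= #|` J|)%N ->
  exists A, [/\ A \in indep M, I `<=` A, A `<=` I `|` J & #|` A| = #|` J|].
Proof.
have [_ _ _ aug] := matroidP M.
move=> + IJ; move En: (#|` J| - #|` I|)%N => n.
elim: n I En => [|n IHn] I En II le_IJ.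
  exists I; split; rewrite ?fsubsetUl //.
  by apply/eqP; rewrite eqn_leq le_IJ -subn_eq0 En.
have [|x] := aug _ _ II IJ; first by rewrite -subn_gt0 En.
rewrite inE => /andP[xI xJ] IxI.
have cxI : #|` x |` I| = #|` I|.+1 by rewrite cardfsU1 xI add1n.
have [|||A [IA sA sAU cA]] := IHn (x |` I); rewrite ?cxI //.
- by rewrite subnS En.
- by rewrite -subn_gt0 En.
exists A; split=> //; first by apply: fsubset_trans sA; exact: fsubsetUr.
apply: (fsubset_trans sAU); rewrite -fsetUA fsubUset fsubset_refl andbT.
by rewrite fsub1set inE xJ orbT.
Qed.

Lemma deletionC M x y : deletion (deletion M x) y = deletion (deletion M y) x.
Proof.
apply: matroid_ext => [|A]; first exact: ground_minorC.
by rewrite !mem_deletion andbAC.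
Qed.

Lemma basis_card M A B : A \in indep M -> B \in bases M -> (#|` A| <= #|` B|)%N.
Proof.
have [_ _ _ aug] := matroidP M; move=> IA /basesP[IB mB].
rewrite leqNgt; apply/negP => /(aug _ _ IB IA)[x].
by rewrite inE => /andP[xB _] /mB/(_ (fsubsetUr _ _)) e; move: xB; rewrite -e !inE eqxx.
Qed.

Lemma noncoloopP M x : x \in ground M ->
  reflect (exists2 B, B \in bases M & x \notin B) (noncoloop M x).
Proof. by move=> xE; rewrite /noncoloop /coloop xE; apply: (iffP allPn). Qed.

Lemma noncoloop2P M x y : x \in ground M -> y \in ground M -> y != x ->
  reflect (exists2 B, B \in bases M & (x \notin B) && (y \notin B))
    (noncoloop M x && noncoloop (deletion M x) y).
Proof.
move=> xE yE nyx; have yE' : y \in ground (deletion M x) by rewrite !inE nyx.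
have [_ _ _ aug] := matroidP M.
apply: (iffP andP) => [[/(noncoloopP xE)[B0 bB0 xB0] /(noncoloopP yE')[B bB yB]]|].
  exists B; last first.
    by rewrite yB andbT; have /basesP[] := bB; rewrite mem_deletion => /andP[].
  have /basesP[IB0 _] := bB0; have /basesP[] := bB.
  rewrite mem_deletion => /andP[IB xB] mB.
  apply/basesP; split=> // A IA BA.
  apply/esym/eqP; rewrite eqEfcard BA (leq_trans (basis_card IA bB0)) //.
  rewrite leqNgt; apply/negP => /(aug _ _ IB IB0)[z].
  rewrite inE => /andP[zB zB0] IzB.
  have e : z |` B = B.
    apply: mB (fsubsetUr _ _); rewrite mem_deletion IzB !inE negb_or xB andbT.
    by apply: contraNneq xB0 => ->.
  by move: zB; rewrite -e !inE eqxx.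
case=> B bB /andP[xB yB]; split; first by apply/noncoloopP => //; exists B.
apply/noncoloopP => //; exists B => //; have /basesP[IB mB] := bB.
apply/basesP; split; first by rewrite mem_deletion IB.
by move=> A; rewrite mem_deletion => /andP[IA _]; exact: mB.
Qed.

Lemma noncoloopC M x y : x \in ground M -> y \in ground M -> y != x ->
  noncoloop M x && noncoloop (deletion M x) y =
  noncoloop M y && noncoloop (deletion M y) x.
Proof.
move=> xE yE nyx; have nxy : x != y by rewrite eq_sym.
by apply/noncoloop2P/noncoloop2P => // -[B bB]; rewrite andbC; exists B.
Qed.

Lemma parallel_indep M x y A : [fset y] \in indep M -> [fset x; y] \notin indep M ->
  x \notin A -> y \notin A -> x |` A \in indep M -> y |` A \in indep M.
Proof.
move=> Iy dxy xA yA IxA.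
have [|B [IB yB sB cB]] := indep_aug Iy IxA.
  by rewrite cardfs1 cardfsU1 xA.
have xB : x \notin B.
  by apply: contra dxy => xB; apply: indepS IB _; rewrite fsubUset yB fsub1set xB.
suff <- : B = y |` A by [].
apply/eqP; rewrite eqEfcard cB !cardfsU1 xA yA leqnn andbT.
apply/fsubsetP => z zB; have := fsubsetP sB z zB; rewrite !inE => /or3P[->//|/eqP ez|->].
  by rewrite ez (negbTE xB) in zB.
by rewrite orbT.
Qed.

Lemma mem_contraction2 M x y A : y != x ->
  (A \in indep (contraction (contraction M x) y)) =
  [&& x \notin A, y \notin A &
     (if [fset x; y] \in indep M then x |` (y |` A)
      else if [fset x] \in indep M then x |` A
      else if [fset y] \in indep M then y |` A else A) \in indep M].
Proof.
move=> nyx; rewrite mem_contraction (mem_contraction M x [fset y]) in_fset1 (eq_sym x y) nyx /=.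
have xy : [fset x; y] \in indep M -> [fset x] \in indep M.
  by move=> /indepS; apply; exact: fsubsetUl.
case: (boolP ([fset x] \in indep M)) => [px|/negbTE npx].
  case: ifP => _; rewrite mem_contraction px ?in_fset1U ?negb_or ?(eq_sym x y) ?nyx //=.
    by rewrite andbCA.
  by rewrite andbCA.
have -> : ([fset x; y] \in indep M) = false by apply: contraFF npx.
by case: ifP => _; rewrite mem_contraction npx ?in_fset1U ?negb_or ?(eq_sym x y) ?nyx /=;
  rewrite andbCA.
Qed.

Lemma contractionC M x y : y != x ->
  contraction (contraction M x) y = contraction (contraction M y) x.
Proof.
move=> nyx; apply: matroid_ext => [|A]; first exact: ground_minorC.
have nxy : x != y by rewrite eq_sym.
rewrite !mem_contraction2 // (fsetUC [fset y] [fset x]) (fsetUCA [fset y]) andbCA.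
case: (boolP (y \in A)) => //= yA; case: (boolP (x \in A)) => //= xA.
case: ifPn => // dxy; case: ifP => // px; case: ifP => // py.
have dyx : [fset y; x] \notin indep M by rewrite fsetUC.
by apply/idP/idP; apply: parallel_indep.
Qed.

Lemma nonloopC M x y : x \in ground M -> y \in ground M -> y != x ->
  nonloop M x && nonloop (contraction M x) y =
  nonloop M y && nonloop (contraction M y) x.
Proof.
move=> xE yE nyx; rewrite /nonloop /loop xE yE !in_fsetD1 xE yE (eq_sym x y) nyx /=.
rewrite !negbK !mem_contraction !in_fset1 (eq_sym x y) nyx /= (fsetUC [fset y] [fset x]).
have [sx sy] : [fset x] `<=` [fset x; y] /\ [fset y] `<=` [fset x; y].
  by split; [exact: fsubsetUl | exact: fsubsetUr].
case: (boolP ([fset x] \in indep M)) => px; case: (boolP ([fset y] \in indep M)) => py //=.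
  by apply: contraNF py => /indepS; apply.
by apply/esym; apply: contraNF px => /indepS; apply.
Qed.

End MatroidMinors.

Section Complexes.
Context (K : choiceType).
Implicit Types (M N : matroid K) (s : osym K) (x y : K) (v : mspace K).

Lemma mspace_ind (Q : mspace K -> Prop) :
    Q 0 -> (forall a u v, Q u -> Q v -> Q (a *: u + v)) ->
    (forall s, Q (oclass s)) -> forall v, Q v.
Proof. exact: presented_ind. Qed.

Lemma bd_delE s : bd_del (oclass s) = boundary_osym (@deletion_ground K) (@noncoloop K) s.
Proof. exact: extend_gen. Qed.

Lemma bd_conE s : bd_con (oclass s) = boundary_osym (@contraction_ground K) (@nonloop K) s.
Proof. exact: extend_gen. Qed.

Lemma bd_del_totE s :
  bd_del_tot (oclass s) = boundary_osym (@deletion_ground K) (fun=> xpredT) s.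
Proof.
rewrite /bd_del_tot /= bd_delE [bd_clp _]extend_gen /boundary_osym.
by rewrite [RHS](bigID (fun x : ground (omat s) => noncoloop (omat s) (val x))) /=; congr (_ + _);
  apply: eq_bigl => x; rewrite ?negbK.
Qed.

Lemma bd_con_totE s :
  bd_con_tot (oclass s) = boundary_osym (@contraction_ground K) (fun=> xpredT) s.
Proof.
rewrite /bd_con_tot /= bd_conE [bd_lp _]extend_gen /boundary_osym.
by rewrite [RHS](bigID (fun x : ground (omat s) => loop (omat s) (val x))).
Qed.

Section Generic.
Context (op : matroid K -> K -> matroid K) (P : matroid K -> pred K).
Context (opE : forall M x, ground (op M x) = ground M `\ x).
Context (d : {linear mspace K -> mspace K}).
Context (dE : forall s, d (oclass s) = boundary_osym opE P s).

Lemma boundary_degree n v : mdeg n.+1 v -> mdeg n (d v).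
Proof.
elim/lspan_ind_lin => [|k b c Hb Hc|_ [s cs ->]].
- by rewrite linear0; exact: lspan0.
- by rewrite linearP; apply: lspanD => //; exact: lspanZ.
rewrite dE; apply: lspan_sum => x _; apply: lspan_gen; eexists; last by [].
by rewrite /omat /= opE; move: cs; rewrite (cardfsD1 (val x)) (valP x) add1n => -[].
Qed.

Lemma boundary_degree0 v : mdeg 0 v -> d v = 0.
Proof.
elim/lspan_ind_lin => [|k b c Hb Hc|_ [s cs ->]].
- by rewrite linear0.
- by rewrite linearP /= Hb Hc scaler0 addr0.
by rewrite dE boundary_osymE big_seq_cond big1 // => x; rewrite (cardfs0_eq cs) in_fset0.
Qed.

Context (dC : forall M x y, x \in ground M -> y \in ground M -> y != x ->
  P M x && P (op M x) y = P M y && P (op M y) x).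
Context (opC : forall M x y, y != x -> op (op M x) y = op (op M y) x).

Lemma boundary_square v : d (d v) = 0.
Proof.
elim/mspace_ind: v => [|k u v IHu IHv|s]; first by rewrite !linear0.
  by rewrite !linearP /= IHu IHv scaler0 addr0.
set M := omat s; set E := ground M.
pose C x y := [&& y != x, P M x & P (op M x) y].
pose F x y := symbol (op (op M x) y) (interior y (interior x (oeta s))).
have -> : d (d (oclass s)) = \sum_(x <- E) \sum_(y <- E | C x y) F x y.
  rewrite dE linear_sum [RHS]big_seq_fsetE /= big_mkcond /=.
  apply: eq_bigr => x _; case: ifPn => Px; last first.
    by rewrite big1 // => y; rewrite /C (negbTE Px) andbF.
  rewrite dE boundary_osymE /= opE -big_filter -[RHS]big_filter.
  apply: perm_big; apply: uniq_perm; rewrite ?filter_uniq ?fset_uniq // => y.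
  by rewrite !mem_filter !inE /C /= Px /= andbCA andbA.
set T := LHS; have TN : T = - T.
  rewrite {1}/T (exchange_big_dep xpredT) //= /T -sumrN.
  rewrite big_seq [RHS]big_seq; apply: eq_bigr => x xE; rewrite -sumrN.
  rewrite big_seq_cond [RHS]big_seq_cond; apply: eq_big => [y|y].
    case: (boolP (y \in E)) => //= yE; rewrite /C eq_sym.
    by case: (eqVneq y x) => //= nyx; rewrite dC // eq_sym.
  case/and3P=> yE nyx _; rewrite /F opC // -symbolN; congr symbol.
  by rewrite interiorC.
have -> : T = 2^-1 *: (T + T).
  by rewrite -mulr2n -scaler_nat scalerA mulVf ?scale1r.
by rewrite {1}TN addNr scaler0.
Qed.

End Generic.
End Complexes.

(* A complex is given by its total space with the family of its homogeneous   *)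
(* subspaces.                                                                 *)
Record complex (R : nzRingType) := Complex {
  cspace : lmodType R;
  cdeg : nat -> cspace -> Prop;
  cdiff : {linear cspace -> cspace};
  cdiff_deg : forall n v, cdeg n.+1 v -> cdeg n (cdiff v);
  cdiff_deg0 : forall v, cdeg 0 v -> cdiff v = 0;
  cdiff_square : forall v, cdiff (cdiff v) = 0 }.

Definition acyclic (R : nzRingType) (C : complex R) : Prop :=
  forall (n : nat) (v : cspace C), cdeg n v -> cdiff C v = 0 ->
    exists2 u, cdeg n.+1 u & cdiff C u = v.

Definition complex_del (K : choiceType) : complex rat :=
  @Complex rat (mspace K) (@mdeg K) (@bd_del K)
  (boundary_degree (@bd_delE K)) (boundary_degree0 (@bd_delE K))
  (boundary_square (@bd_delE K) (@noncoloopC K) (fun M x y _ => deletionC M x y)).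

Definition complex_con (K : choiceType) : complex rat :=
  @Complex rat (mspace K) (@mdeg K) (@bd_con K)
  (boundary_degree (@bd_conE K)) (boundary_degree0 (@bd_conE K))
  (boundary_square (@bd_conE K) (@nonloopC K) (@contractionC K)).

Definition complex_del_tot (K : choiceType) : complex rat :=
  @Complex rat (mspace K) (@mdeg K) (@bd_del_tot K)
  (boundary_degree (@bd_del_totE K)) (boundary_degree0 (@bd_del_totE K))
  (boundary_square (@bd_del_totE K) (fun _ _ _ _ _ _ => erefl)
     (fun M x y _ => deletionC M x y)).

Definition complex_con_tot (K : choiceType) : complex rat :=
  @Complex rat (mspace K) (@mdeg K) (@bd_con_tot K)
  (boundary_degree (@bd_con_totE K)) (boundary_degree0 (@bd_con_totE K))
  (boundary_square (@bd_con_totE K) (fun _ _ _ _ _ _ => erefl) (@contractionC K)).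

(* Main.v *)
(** Adjoin a fresh element [c] to every matroid, as a loop for the two deletion
    complexes and as a coloop for the two contraction complexes.  Removing [c]
    again gives back the matroid, and removing any other element commutes with
    adjoining [c], without changing which elements the boundary sums over.
    Hence [[M, eta] |-> [M + c, c /\ eta]] is a contracting homotopy: the term
    [x = c] of the boundary gives [[M, eta]], and the other ones give minus the
    homotopy of the boundary, by [iota_x (c /\ eta) = - c /\ iota_x eta]. *)
Require Import Defs.
From HB Require Import structures.
From mathcomp Require Import all_boot all_order all_algebra finmap boolp.
From mathcomp.multinomials Require Import freeg.

Set Implicit Arguments.
Unset Strict Implicit.
Unset Printing Implicit Defensive.

Import GRing.Theory.

(** * Orientations and pushforwards after adjoining one element *)

Section AdjoinOrientation.
Local Open Scope fset_scope.
Local Open Scope ring_scope.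
Context (K : choiceType).
Implicit Types (c d x : K) (E : {fset K}) (a eta : ext K) (f g : K -> K).

(** A word of length |E| + 1 over [E] and [c] either contains [c], and then wedging with [c] repeats
    a letter, or is too long a word over [E] to be free of repetitions. *)
Lemma extpow_top_mulx0 E c a : extpow #|` E|.+1 (c |` E) a -> mulx c a = 0.
Proof.
elim/lspan_ind_lin => [|k u v Hu Hv|_ [w [sw wE ->]]].
- exact: linear0.
- by rewrite linearP /= Hu Hv scaler0 addr0.
rewrite mulxE; have [/wedge_mem //|cw] := boolP (c \in w).
rewrite wedge_nuniq //= cw /=; apply/negP => uw.
have : (size w <= size E)%N.
  apply: uniq_leq_size => // x xw; have := wE x xw; rewrite !inE.
  by case/predU1P=> // ex; rewrite -ex xw in cw.
by rewrite sw ltnn.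
Qed.

Lemma orientation_mulx E c eta :
  c \notin E -> orientation E eta -> orientation (c |` E) (mulx c eta).
Proof.
move=> cE [eE egen].
have cU : #|` c |` E| = #|` E|.+1 by rewrite cardfsU1 cE add1n.
rewrite /orientation cU; split.
  by apply: extpow_mulx; rewrite ?fset1U1 //; exact: extpow_sub (fsubsetUr _ _) eE.
move=> a aE.
(* In top degree [mulx c a] vanishes, so the Leibniz rule for [interior c] writes [a] as a multiple
   of [c]; the cofactor is then a top form on [E]. *)
have {}ea : a = mulx c (interior c a).
  apply/eqP; rewrite -subr_eq0; have := interior_mulx c c a.
  by rewrite eqxx scale1r (extpow_top_mulx0 aE) linear0 => <-.
have [|k ek] := egen (interior c a); last by exists k; rewrite ea ek linearZ.
by have := extpow_interior c aE; rewrite fsetU1K.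
Qed.

Lemma eq_pushforward_in f g n E a :
  {in E, f =1 g} -> extpow n E a -> pushforward f a = pushforward g a.
Proof.
move=> fg; elim/lspan_ind_lin => [|k u v Hu Hv|_ [w [_ wE ->]]].
- by rewrite !linear0.
- by rewrite !linearP /= Hu Hv.
by rewrite !pushforwardE; congr wedge; apply/eq_in_map => x /wE /fg.
Qed.

Lemma pushforward_id a : pushforward id a = a.
Proof.
elim/ext_ind: a => [|k u v Hu Hv|w]; first exact: linear0.
  by rewrite linearP /= Hu Hv.
by rewrite pushforwardE map_id.
Qed.

(** Two labels are needed because isomorphic matroids on different ground sets may receive different
    new elements. *)
Definition adjoin_fun f c d x : K := if x == c then d else f x.

Lemma adjoin_fun_in f c d E : c \notin E -> {in E, adjoin_fun f c d =1 f}.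
Proof.
by move=> cE x xE; rewrite /adjoin_fun; case: eqVneq => // ex; rewrite -ex xE in cE.
Qed.

Lemma pushforward_adjoin f c d n E a : c \notin E -> extpow n E a ->
  pushforward (adjoin_fun f c d) (mulx c a) = mulx d (pushforward f a).
Proof.
move=> cE aE; rewrite pushforward_mulx /adjoin_fun eqxx.
by rewrite (eq_pushforward_in (adjoin_fun_in f d cE) aE).
Qed.

End AdjoinOrientation.

(** * The contracting homotopy, for any removal operation and any compatible way of adjoining an
    element *)

Section ContractingHomotopy.
Local Open Scope fset_scope.
Local Open Scope ring_scope.
Context (K : choiceType).
Context (K_infinite : forall A : {fset K}, exists x : K, x \notin A).
Context (op : matroid K -> K -> matroid K) (P : matroid K -> pred K).
Context (opE : forall M x, ground (op M x) = ground M `\ x).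
Context (d : {linear mspace K -> mspace K}).
Context (dE : forall s, d (oclass s) = boundary_osym opE P s).
Context (adj : matroid K -> K -> matroid K).
Context (adjE : forall M c, ground (adj M c) = c |` ground M).
Context (adj_iso : forall psi M N c c', matroid_iso psi M N ->
  c \notin ground M -> c' \notin ground N ->
  matroid_iso (adjoin_fun psi c c') (adj M c) (adj N c')).
Context (op_adj : forall M c, c \notin ground M -> op (adj M c) c = M).
Context (op_adjC : forall M c x, x != c -> op (adj M c) x = adj (op M x) c).
Context (P_adj : forall M c, c \notin ground M -> P (adj M c) c).
Context (P_adjC : forall M c x, x \in ground M -> c \notin ground M ->
  P (adj M c) x = P M x).
Implicit Types (M N : matroid K) (s : osym K) (c x : K) (eta : ext K).

Definition fresh (A : {fset K}) : K := xchoose (K_infinite A).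

Lemma freshP (A : {fset K}) : fresh A \notin A.
Proof. exact: (xchooseP (K_infinite A)). Qed.

Definition adjoin_symbol M eta c : mspace K := symbol (adj M c) (mulx c eta).

Lemma adjoin_symbol_iso psi M N eta c c' :
    orientation (ground M) eta -> orientation (ground N) (pushforward psi eta) ->
    matroid_iso psi M N -> c \notin ground M -> c' \notin ground N ->
  adjoin_symbol N (pushforward psi eta) c' = adjoin_symbol M eta c.
Proof.
move=> HM HN iso cM cN; have [eM _] := HM.
rewrite /adjoin_symbol -(pushforward_adjoin psi c' cM eM).
apply: symbol_iso; last exact: adj_iso.
  by rewrite adjE; exact: orientation_mulx.
by rewrite (pushforward_adjoin psi c' cM eM) adjE; exact: orientation_mulx.
Qed.

Lemma matroid_iso_id M : matroid_iso id M M.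
Proof. by split=> [x y _ _ //||A _]; rewrite imfset_id. Qed.

Lemma adjoin_symbol_fresh M eta c c' : orientation (ground M) eta ->
    c \notin ground M -> c' \notin ground M ->
  adjoin_symbol M eta c' = adjoin_symbol M eta c.
Proof.
move=> HM cM c'M; rewrite -{1}[eta]pushforward_id.
by apply: adjoin_symbol_iso => //; [rewrite pushforward_id | exact: matroid_iso_id].
Qed.

Definition homotopy_osym s : mspace K :=
  adjoin_symbol (omat s) (oeta s) (fresh (ground (omat s))).

(** Opposite orientations share a ground set and so the same fresh label; isomorphic symbols may
    have different ones, which [adjoin_symbol_iso] matches. *)
Fact homotopy_respects : respects (@osym_rel K) homotopy_osym.
Proof.
move=> _ [s t es et|s t psi iso et].
  rewrite raddfD /= !liftU !scale1r /homotopy_osym es et /adjoin_symbol.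
  by rewrite linearN /= symbolN addNr.
rewrite raddfB /= !liftU !scale1r; apply/eqP; rewrite subr_eq0; apply/eqP.
rewrite /homotopy_osym et; apply/esym/adjoin_symbol_iso => //; try exact: freshP.
  exact: osymP.
by rewrite -et; exact: osymP.
Qed.

Definition homotopy : mspace K -> mspace K := extend homotopy_respects.
HB.instance Definition _ := GRing.Linear.on homotopy.

Lemma homotopyE s : homotopy (oclass s) = homotopy_osym s.
Proof. exact: extend_gen. Qed.

Lemma boundary_symbol M eta : orientation (ground M) eta ->
  d (symbol M eta) =
  \sum_(x <- ground M | P M x) symbol (op M x) (interior x eta).
Proof. by move=> HM; rewrite (symbolE HM) dE boundary_osymE. Qed.

Lemma homotopy_symbol M eta c : orientation (ground M) eta -> c \notin ground M ->
  homotopy (symbol M eta) = adjoin_symbol M eta c.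
Proof.
move=> HM cM; rewrite (symbolE HM) homotopyE.
by apply: adjoin_symbol_fresh => //; exact: freshP.
Qed.

Lemma homotopy_formula v : d (homotopy v) + homotopy (d v) = v.
Proof.
elim/mspace_ind: v => [|k u v IHu IHv|s]; first by rewrite !linear0 addr0.
  by rewrite !linearP /= -{3}IHu -{3}IHv scalerDr addrACA.
rewrite oclassE; set M := omat s; set eta := oeta s.
have HM : orientation (ground M) eta := osymP s; have [eM _] := HM.
(* This [c] is also outside the ground set of every [op M x], so by [homotopy_symbol] it can replace
   all the labels picked by [fresh] at once. *)
have [c cM] := K_infinite (ground M).
have HMc : orientation (ground (adj M c)) (mulx c eta).
  by rewrite adjE; exact: orientation_mulx.
rewrite (homotopy_symbol HM cM) /adjoin_symbol !boundary_symbol // adjE.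
(* The term of [c] carries the orientation [eta - mulx c (interior c eta)], which is [eta] because
   [eta] does not involve [c]. *)
rewrite big_mkcond big_fsetU1 //= P_adj // op_adj // interior_mulx eqxx scale1r.
rewrite (extpow_interior0 cM eM) linear0 subr0 -addrA -[RHS]addr0; congr (_ + _).
(* The other terms cancel for each [x] separately. *)
rewrite linear_sum /= [X in _ + X]big_mkcond -big_split /= big_seq big1 // => x xM.
rewrite P_adjC //; case: ifP => _; last exact: addr0.
have nxc : x != c by apply: contraNneq cM => <-.
have Hx : orientation (ground (op M x)) (interior x eta).
  by rewrite opE; exact: orientation_interior.
rewrite op_adjC // interior_mulx (negbTE nxc) scale0r sub0r symbolN.
rewrite (homotopy_symbol Hx (c := c)) ?addNr // opE.
by rewrite !inE (negbTE cM) andbF.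
Qed.

Lemma homotopy_degree n v : mdeg n v -> mdeg n.+1 (homotopy v).
Proof.
elim/lspan_ind_lin => [|k u w Hu Hw|_ [s cs ->]].
- by rewrite linear0; exact: lspan0.
- by rewrite linearP; apply: lspanD => //; exact: lspanZ.
have fs := freshP (ground (omat s)).
have Hs : orientation (ground (adj (omat s) (fresh (ground (omat s)))))
    (mulx (fresh (ground (omat s))) (oeta s)).
  by rewrite adjE; apply: orientation_mulx => //; exact: osymP.
rewrite homotopyE /homotopy_osym /adjoin_symbol (symbolE Hs).
apply: lspan_gen; eexists; last by [].
by rewrite /omat /= adjE cardfsU1 fs cs.
Qed.

Lemma homotopy_exact n v : mdeg n v -> d v = 0 ->
  exists2 u, mdeg n.+1 u & d u = v.
Proof.
move=> nv dv; exists (homotopy v); first exact: homotopy_degree.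
by rewrite -[RHS]homotopy_formula dv linear0 addr0.
Qed.

End ContractingHomotopy.

(** * Adjoining a loop, and its compatibility with deletion *)

Section AdjoinLoop.
Local Open Scope fset_scope.
Context (K : choiceType).
Implicit Types (M N : matroid K) (c x : K) (A B E : {fset K}) (f : K -> K).

(** An independent set of maximal cardinality is maximal for inclusion. *)
Lemma bases_nonempty M : exists B, B \in bases M.
Proof.
have [_ I0 _ _] := matroidP M.
pose i0 : indep M := [` I0].
case: (@arg_maxnP _ i0 xpredT (fun A : indep M => #|` val A|)) => // B _ maxB.
exists (val B); apply/basesP; split=> [|A IA BA]; first exact: valP.
apply/esym/eqP; rewrite eqEfcard BA; exact: (maxB [` IA]).
Qed.

Lemma adjoin_fun_image f c c' A : c \notin A -> adjoin_fun f c c' @` A = f @` A.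
Proof. by move=> cA; apply: eq_in_imfset => // x /(adjoin_fun_in f c' cA). Qed.

Lemma adjoin_fun_bij f c c' E E' : c \notin E -> c' \notin E' ->
    {in E &, injective f} -> f @` E = E' ->
  {in c |` E &, injective (adjoin_fun f c c')} /\
  adjoin_fun f c c' @` (c |` E) = c' |` E'.
Proof.
move=> cE cE' injf im; split; last first.
  by rewrite imfsetU1 adjoin_fun_image // im /adjoin_fun eqxx.
have fE x : x \in E -> f x == c' = false.
  by move=> xE; apply: contraNF cE' => /eqP <-; rewrite -im in_imfset.
move=> x y; rewrite !inE /adjoin_fun.
case: eqVneq => [->|_] /=; case: eqVneq => [->|_] //=.
- by move=> _ yE /eqP; rewrite eq_sym fE.
- by move=> xE _ /eqP; rewrite fE.
- exact: injf.
Qed.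

Fact add_loop_subproof M c : matroid_axioms (c |` ground M) (indep M).
Proof.
have [IE I0 Isub Iaug] := matroidP M; split=> // A /IE AE.
exact: fsubset_trans AE (fsubsetUr _ _).
Qed.

Definition add_loop M c : matroid K :=
  @Matroid K (c |` ground M, indep M) (introT (asboolP _) (add_loop_subproof M c)).

Lemma indep_notin M c A : c \notin ground M -> A \in indep M -> c \notin A.
Proof. by move=> cM /indep_ground/fsubsetP AE; apply: contra cM => /AE. Qed.

Lemma add_loop_iso f M N c c' : matroid_iso f M N ->
    c \notin ground M -> c' \notin ground N ->
  matroid_iso (adjoin_fun f c c') (add_loop M c) (add_loop N c').
Proof.
move=> [injf im isoI] cM cN; have [inj im'] := adjoin_fun_bij cM cN injf im.
split=> // A AE; rewrite [indep (add_loop M c)]/(indep M) [indep (add_loop _ _)]/(indep N).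
(* A set containing [c] is independent on neither side: its image contains [c'], which lies outside
   [N]. *)
case: (boolP (c \in A)) => cA.
  have -> : (A \in indep M) = false by apply: contraTF cA; exact: indep_notin.
  apply/esym/negbTE/negP => /(indep_notin cN)/negP; apply.
  by apply/imfsetP; exists c; rewrite // /adjoin_fun eqxx.
rewrite adjoin_fun_image // isoI //; apply/fsubsetP => x xA.
by have := fsubsetP AE x xA; rewrite !inE => /predU1P[ex|//]; rewrite -ex xA in cA.
Qed.

Lemma deletion_add_loop M c : c \notin ground M -> deletion (add_loop M c) c = M.
Proof.
move=> cM; apply: matroid_ext => [|A]; first by rewrite deletion_ground fsetU1K.
rewrite mem_deletion [indep (add_loop _ _)]/(indep M) andb_idr //; exact: indep_notin.
Qed.

Lemma fsetU1D1C c x E : x != c -> (c |` E) `\ x = c |` (E `\ x).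
Proof.
move=> nxc; apply/fsetP => y; rewrite !inE.
by case: (eqVneq y c) => [->|] //=; rewrite eq_sym nxc.
Qed.

Lemma deletion_add_loopC M c x :
  x != c -> deletion (add_loop M c) x = add_loop (deletion M x) c.
Proof. by move=> nxc; apply: matroid_ext => [|A //]; exact: fsetU1D1C. Qed.

Lemma noncoloop_add_loop M c : c \notin ground M -> noncoloop (add_loop M c) c.
Proof.
move=> cM; have [B bB] := bases_nonempty M.
apply/noncoloopP; first exact: fset1U1.
by exists B => //; have /basesP[/(indep_notin cM)] := bB.
Qed.

(** [bases] is computed from the independent sets alone, and these are unchanged. *)
Lemma noncoloop_add_loopC M c x :
  x \in ground M -> noncoloop (add_loop M c) x = noncoloop M x.
Proof. by move=> xM; rewrite /noncoloop /coloop xM [x \in _]fset1Ur. Qed.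

End AdjoinLoop.

(** * Adjoining a coloop, and its compatibility with contraction *)

Section AdjoinColoop.
Local Open Scope fset_scope.
Context (K : choiceType).
Implicit Types (M N : matroid K) (c x : K) (A B E : {fset K}) (f : K -> K).

(** The direct sum of [M] with a coloop when [c] is new: [c] may be added freely to any independent
    set. The power set serves to make the family finite. *)
Definition add_coloop_indep M c : {fset {fset K}} :=
  [fset A in fpowerset (c |` ground M) | A `\ c \in indep M].

Lemma mem_add_coloop_indep M c A : (A \in add_coloop_indep M c) = (A `\ c \in indep M).
Proof.
rewrite !inE /= fpowersetE andb_idl // => /indep_ground AE.
by rewrite -fsubDset.
Qed.

Fact add_coloop_subproof M c : matroid_axioms (c |` ground M) (add_coloop_indep M c).
Proof.
have [IE I0 Isub Iaug] := matroidP M; split.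
- by move=> A; rewrite !inE /= fpowersetE => /andP[].
- by rewrite mem_add_coloop_indep fset0D.
- move=> A B; rewrite !mem_add_coloop_indep => IB AB.
  by apply: Isub IB _; exact: fsetSD.
move=> A B; rewrite !mem_add_coloop_indep => IA IB cAB.
(* If [c] lies in [B] only, it augments [A] by itself. *)
have [/andP[cA cB]|cAcB] := boolP ((c \notin A) && (c \in B)).
  exists c; first by rewrite inE cA.
  by rewrite mem_add_coloop_indep fsetU1K // -(mem_fsetD1 cA).
(* Otherwise removing [c] from both sets keeps the strict inequality of sizes, and augmentation in
   [M] applies. *)
have [|x] := Iaug _ _ IA IB.
  move: cAB cAcB; rewrite (cardfsD1 c A) (cardfsD1 c B).
  case: (c \in A); case: (c \in B) => //=.
  by rewrite add1n => /ltnW.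
rewrite !inE negb_and negbK => /andP[+ /andP[nxc xB]]; rewrite (negbTE nxc) /= => xA IxA.
exists x; first by rewrite !inE xA.
by rewrite mem_add_coloop_indep fsetU1D1C 1?eq_sym.
Qed.

Definition add_coloop M c : matroid K :=
  @Matroid K (c |` ground M, add_coloop_indep M c)
    (introT (asboolP _) (add_coloop_subproof M c)).

Lemma mem_add_coloop M c A : (A \in indep (add_coloop M c)) = (A `\ c \in indep M).
Proof. exact: mem_add_coloop_indep. Qed.

Lemma add_coloop_iso f M N c c' : matroid_iso f M N ->
    c \notin ground M -> c' \notin ground N ->
  matroid_iso (adjoin_fun f c c') (add_coloop M c) (add_coloop N c').
Proof.
move=> [injf im isoI] cM cN; have [inj im'] := adjoin_fun_bij cM cN injf im.
split=> // A AE; rewrite !mem_add_coloop.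
have AcE : A `\ c `<=` ground M by rewrite fsubDset.
(* It remains that taking images commutes with removing the new element, since only [c] is sent to
   [c']. *)
rewrite isoI //; suff -> : f @` (A `\ c) = (adjoin_fun f c c' @` A) `\ c' by [].
apply/fsetP => y; rewrite !inE.
apply/imfsetP/andP => [[x /=]|[nyc' /imfsetP[x /= xA]]].
  rewrite !inE => /andP[nxc xA] ->; split.
    apply: contraNneq cN => <-; rewrite -im in_imfset //.
    by apply: (fsubsetP AcE); rewrite !inE nxc.
  by apply/imfsetP; exists x; rewrite // /adjoin_fun (negbTE nxc).
rewrite /adjoin_fun; case: eqVneq => [_ ey|nxc ey]; first by rewrite ey eqxx in nyc'.
by exists x; rewrite //= !inE nxc.
Qed.

Lemma contraction_add_coloop M c :
  c \notin ground M -> contraction (add_coloop M c) c = M.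
Proof.
move=> cM; apply: matroid_ext => [|A]; first by rewrite contraction_ground fsetU1K.
have [_ I0 _ _] := matroidP M.
(* The singleton of [c] is independent, as removing [c] leaves the empty set; contraction therefore
   tests the union of [A] with [c]. *)
rewrite mem_contraction (mem_add_coloop M c [fset c]) fsetDv I0 mem_add_coloop.
case: (boolP (c \in A)) => cA /=; last by rewrite fsetU1K.
by apply/esym; apply: contraTF cA; exact: indep_notin.
Qed.

(** Adjoining [c] does not change whether [x] is a loop, so both contractions follow the same case
    of the definition. *)
Lemma contraction_add_coloopC M c x :
  x != c -> contraction (add_coloop M c) x = add_coloop (contraction M x) c.
Proof.
move=> nxc; apply: matroid_ext => [|A]; first exact: fsetU1D1C.
have ncx : c != x by rewrite eq_sym.
rewrite mem_add_coloop !mem_contraction (mem_add_coloop M c [fset x]).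
rewrite (mem_fsetD1 (A := [fset x])) ?in_fset1 // in_fsetD1 nxc /=.
by case: ifP => _; rewrite mem_add_coloop // fsetU1D1C.
Qed.

Lemma nonloop_add_coloop M c : nonloop (add_coloop M c) c.
Proof.
have [_ I0 _ _] := matroidP M.
by rewrite /nonloop /loop mem_add_coloop fsetDv I0 andbF.
Qed.

Lemma nonloop_add_coloopC M c x : x \in ground M -> c \notin ground M ->
  nonloop (add_coloop M c) x = nonloop M x.
Proof.
move=> xM cM; rewrite /nonloop /loop xM [x \in _]fset1Ur // mem_add_coloop.
by rewrite (mem_fsetD1 (A := [fset x])) // inE; apply: contraNneq cM => ->.
Qed.

End AdjoinColoop.

Theorem theorem5p13 (K : choiceType)
    (K_infinite : forall A : {fset K}, exists x : K, x \notin A) :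
  [/\ acyclic (complex_del K),
      acyclic (complex_del_tot K),
      acyclic (complex_con K) &
      acyclic (complex_con_tot K)].
Proof.
split=> n v /=.
- apply: (homotopy_exact K_infinite (@bd_delE K) (adj := @add_loop K)) => //.
  + exact: add_loop_iso.
  + exact: deletion_add_loop.
  + exact: deletion_add_loopC.
  + exact: noncoloop_add_loop.
  + by move=> *; exact: noncoloop_add_loopC.
(* The total boundary sums over all elements, so the conditions on [P] hold trivially. *)
- apply: (homotopy_exact K_infinite (@bd_del_totE K) (adj := @add_loop K)) => //.
  + exact: add_loop_iso.
  + exact: deletion_add_loop.
  + exact: deletion_add_loopC.
- apply: (homotopy_exact K_infinite (@bd_conE K) (adj := @add_coloop K)) => //.
  + exact: add_coloop_iso.
  + exact: contraction_add_coloop.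
  + exact: contraction_add_coloopC.
  + by move=> *; exact: nonloop_add_coloop.
  + exact: nonloop_add_coloopC.
- apply: (homotopy_exact K_infinite (@bd_con_totE K) (adj := @add_coloop K)) => //.
  + exact: add_coloop_iso.
  + exact: contraction_add_coloop.
  + exact: contraction_add_coloopC.
Qed.
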